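(* Let $A$ be a $d_1$-dimensional polystochastic matrix of order $n$ and let $B$ be a $d_2$-dimensional polystochastic matrix of order $n$. Then the circle product $A\circ B$ is a polystochastic matrix.
   Context: Let $I_n^d = \{1,\ldots,n\}^d$ with $n,d$ positive integers. A $d$-dimensional matrix $A$ of order $n$ is an array $(a_\alpha)_{\alpha\in I_n^d}$ of real numbers. A line in $A$ is a submatrix obtained by fixing $d-1$ components of the indices and letting the remaining component vary from $1$ to $n$. $A$ is polystochastic if all its entries are nonnegative and the sum of entries in every line equals $1$. The circle product $A\circ B$ of a $d_1$-dimensional matrix $A$ and a $d_2$-dimensional matrix $B$, both of order $n$, is the $((d_1-1)(d_2-1)+1)$-dimensional matrix $C$ of order $n$ with entries $$c_\gamma=\sum_{j_2,\ldots,j_{d_1}=1}^n a_{i,j_2,\ldots,j_{d_1}}\, b_{j_2\beta_2}\cdots b_{j_{d_1}\beta_{d_1}},$$ where $\gamma=i\beta_2\cdots\beta_{d_1}$ (concatenation), $i\in\{1,\ldots,n\}$, and $\beta_2,\ldots,\beta_{d_1}\in I_n^{d_2-1}$. *)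

(* Defs.v *)
From mathcomp Require Import all_boot all_order all_algebra.
From mathcomp Require Export reals.

Set Implicit Arguments.
Unset Strict Implicit.
Unset Printing Implicit Defensive.

Import Order.TTheory GRing.Theory Num.Theory.
Local Open Scope ring_scope.

(* Indices are numbered from 0: 'I_n stands for {1, ..., n}. *)
Definition mdindex (d n : nat) := d.-tuple 'I_n.

Definition mdmatrix (R : Type) (d n : nat) := {ffun mdindex d n -> R}.

Definition mdindex_set (d n : nat) (k : 'I_d) (alpha : mdindex d n) (x : 'I_n)
    : mdindex d n :=
  [tuple (if l == k then x else tnth alpha l) | l < d].

(* A line is given by its direction k and any index alpha on it: component k
   varies while the other ones stay equal to those of alpha. *)
Definition polystochastic (R : realType) (d n : nat) (A : mdmatrix R d n) :=
  (forall alpha : mdindex d n, 0 <= A alpha) /\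
  (forall (k : 'I_d) (alpha : mdindex d n),
     \sum_(x < n) A (mdindex_set k alpha x) = 1).

Lemma block_pos_subproof (m p : nat) (k : 'I_m) (l : 'I_p) :
  ((k * p + l).+1 < (m * p).+1)%N.
Proof.
rewrite ltnS (@leq_trans (k.+1 * p)%N) ?leq_mul2r ?ltn_ord ?orbT //.
by rewrite mulSn addnC ltn_add2r.
Qed.

Definition block_pos (m p : nat) (k : 'I_m) (l : 'I_p) : 'I_(m * p).+1 :=
  Ordinal (block_pos_subproof k l).

(* If gamma is the concatenation i beta_0 ... beta_(m-1), where each beta_k has
   p components, then block gamma k is beta_k. *)
Definition block (m p n : nat) (gamma : mdindex (m * p).+1 n) (k : 'I_m)
    : mdindex p n :=
  [tuple tnth gamma (block_pos k l) | l < p].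

(* Positive dimensions d1, d2 are written m.+1, p.+1, so that
   (d1 - 1) * (d2 - 1) + 1 is (m * p).+1. *)
Definition circle_product (R : realType) (m p n : nat)
    (A : mdmatrix R m.+1 n) (B : mdmatrix R p.+1 n)
    : mdmatrix R (m * p).+1 n :=
  [ffun gamma : mdindex (m * p).+1 n =>
    \sum_(j : mdindex m n)
      A [tuple of thead gamma :: j] *
      \prod_(k < m) B [tuple of tnth j k :: block gamma k]].

(* Main.v *)
Require Import Defs.
From mathcomp Require Import all_boot all_order all_algebra.

(** Nonnegativity is immediate, so everything is about the line sums of the
    circle product [C]; there are two kinds of lines.

    Along the first component [i], the products of entries of [B] are constant
    and the entries [a_(i, j)] sum to 1 for each [j]; what remains is the sum
    over [j] of the products [\prod_k b_(j_k, beta_k)], which factors as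
    [\prod_k \sum_x b_(x, beta_k) = 1].

    Along a component of some block [beta_k], only the factor [b_(j_k, beta_k)]
    varies, and its sum over the line is 1.  What remains is a sum over [j] of
    [a_(i, j)] weighted by a product of functions of the [j_q], [q != k], hence
    by a weight that does not depend on [j_k]; summing over [j_k] first removes
    [A], and the weights of the other [j_q] factor as before.

    This second summation over the single coordinate [j_k] is done by double
    counting ([sum_mdindex_set]): replacing [j_k] by a new value, for all [j]
    and all new values, reaches each index exactly [n] times.  This avoids
    splitting an index into [j_k] and the others, at the price of a factor [n]
    that is cancelled in [weighted_sum1]. *)

Import GRing.Theory Num.Theory.
Local Open Scope ring_scope.

Lemma tnth_mdindex_set {d n} (k l : 'I_d) (alpha : mdindex d n) x :
  tnth (mdindex_set k alpha x) l = if l == k then x else tnth alpha l.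
Proof. by rewrite tnth_mktuple. Qed.

Lemma mdindex_set_head {d n} (y x : 'I_n) (alpha : mdindex d n) :
  mdindex_set ord0 [tuple of y :: alpha] x = [tuple of x :: alpha].
Proof.
apply: eq_from_tnth => l; rewrite tnth_mdindex_set.
by case: (unliftP ord0 l) => [q|] ->; rewrite ?tnthS ?tnth0.
Qed.

Lemma mdindex_set_behead {d n} (k : 'I_d) (y x : 'I_n) (alpha : mdindex d n) :
  mdindex_set (lift ord0 k) [tuple of y :: alpha] x =
  [tuple of y :: mdindex_set k alpha x].
Proof.
apply: eq_from_tnth => l; rewrite tnth_mdindex_set.
case: (unliftP ord0 l) => [q|] ->; last by rewrite !tnth0.
by rewrite !tnthS tnth_mdindex_set (inj_eq lift_inj).
Qed.

(** The map exchanging a component of an index with an outside value is an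
    involution of the pairs (index, value), which gives the double counting. *)
Lemma sum_mdindex_set {V : nmodType} {d n} (k : 'I_d) (F : mdindex d n -> V) :
  \sum_alpha \sum_(x < n) F (mdindex_set k alpha x) = (\sum_alpha F alpha) *+ n.
Proof.
pose swap (u : mdindex d n * 'I_n) := (mdindex_set k u.1 u.2, tnth u.1 k).
have swapK : involutive swap.
  case=> alpha x; rewrite /swap /= tnth_mdindex_set eqxx; congr pair.
  apply: eq_from_tnth => l; rewrite !tnth_mdindex_set.
  by case: eqP => // ->.
rewrite pair_bigA /= -sumrMnl.
transitivity (\sum_(u : mdindex d n * 'I_n) F u.1).
  by rewrite [RHS](reindex_inj (inv_inj swapK)).
rewrite -(pair_bigA _ (fun alpha _ => F alpha)) /=.
by apply: eq_bigr => alpha _; rewrite sumr_const card_ord.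
Qed.

Lemma sum_mdindex_prod {R : comPzSemiRingType} {d n} (h : 'I_d -> 'I_n -> R) :
  \sum_(alpha : mdindex d n) \prod_k h k (tnth alpha k) =
  \prod_k \sum_(x < n) h k x.
Proof.
rewrite bigA_distr_bigA /=.
rewrite (reindex (fun f : {ffun 'I_d -> 'I_n} => [tuple f k | k < d])) /=.
  apply: eq_bigr => f _; apply: eq_bigr => k _.
  by rewrite tnth_mktuple.
exists (fun alpha : mdindex d n => [ffun k => tnth alpha k]) => [f _|alpha _].
  by apply/ffunP => k; rewrite ffunE tnth_mktuple.
by apply: eq_from_tnth => k; rewrite tnth_mktuple ffunE.
Qed.

Lemma block_pos_eq {m p} (k k' : 'I_m) (l l' : 'I_p) :
  (block_pos k l == block_pos k' l') = (k == k') && (l == l').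
Proof.
apply/eqP/andP => [[E]|[/eqP-> /eqP-> //]].
have p_gt0 : (0 < p)%N by apply: leq_ltn_trans (ltn_ord l).
split; apply/eqP/val_inj => /=.
  by have := congr1 (divn^~ p) E; rewrite !divnMDl // !divn_small // !addn0.
by have := congr1 (modn^~ p) E; rewrite !modnMDl !modn_small.
Qed.

Variant block_spec {m p} : 'I_(m * p).+1 -> Prop :=
  | BlockHead : block_spec ord0
  | BlockPos k l : block_spec (block_pos k l).

Lemma blockP {m p} (s : 'I_(m * p).+1) : block_spec s.
Proof.
case: (unliftP ord0 s) => [q|] ->; last exact: BlockHead.
have q_lt := ltn_ord q.
have /andP[_ p_gt0] : (0 < m)%N && (0 < p)%N.
  by rewrite -muln_gt0; apply: leq_ltn_trans q_lt.
have k_lt : (q %/ p < m)%N by rewrite ltn_divLR.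
have l_lt : (q %% p < p)%N by rewrite ltn_mod.
suff -> : lift ord0 q = block_pos (Ordinal k_lt) (Ordinal l_lt).
  exact: BlockPos.
by apply: val_inj; rewrite /= -divn_eq.
Qed.

Lemma thead_mdindex_set0 {d n} (gamma : mdindex d.+1 n) x :
  thead (mdindex_set ord0 gamma x) = x.
Proof. by rewrite /thead tnth_mdindex_set eqxx. Qed.

Lemma block_mdindex_set0 {m p n} (gamma : mdindex (m * p).+1 n) x (k : 'I_m) :
  block (mdindex_set ord0 gamma x) k = block gamma k.
Proof.
by apply: eq_from_tnth => l; rewrite !tnth_mktuple.
Qed.

Lemma thead_mdindex_set_block {m p n} (gamma : mdindex (m * p).+1 n) x
    (k : 'I_m) (l : 'I_p) :
  thead (mdindex_set (block_pos k l) gamma x) = thead gamma.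
Proof. by rewrite /thead tnth_mdindex_set. Qed.

Lemma block_mdindex_set_block {m p n} (gamma : mdindex (m * p).+1 n) x
    (k q : 'I_m) (l : 'I_p) :
  block (mdindex_set (block_pos k l) gamma x) q =
  if q == k then mdindex_set l (block gamma q) x else block gamma q.
Proof.
apply: eq_from_tnth => r; rewrite tnth_mktuple tnth_mdindex_set block_pos_eq.
by case: eqP => _ /=; rewrite ?tnth_mdindex_set tnth_mktuple.
Qed.

Lemma polystochastic_head {R : realType} {d n} {A : mdmatrix R d.+1 n}
    (hA : polystochastic A) (n_gt0 : (0 < n)%N) (alpha : mdindex d n) :
  \sum_(x < n) A [tuple of x :: alpha] = 1.
Proof.
rewrite -(hA.2 ord0 [tuple of Ordinal n_gt0 :: alpha]).
by apply: eq_bigr => x _; rewrite mdindex_set_head.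
Qed.

Lemma polystochastic_behead {R : realType} {d n} {A : mdmatrix R d.+1 n}
    (hA : polystochastic A) (i : 'I_n) (k : 'I_d) (alpha : mdindex d n) :
  \sum_(x < n) A [tuple of i :: mdindex_set k alpha x] = 1.
Proof.
rewrite -(hA.2 (lift ord0 k) [tuple of i :: alpha]).
by apply: eq_bigr => x _; rewrite mdindex_set_behead.
Qed.

(** Summing over the coordinate [k] first, on which the weight does not depend,
    replaces [A] by 1; the rest is a product of sums equal to 1. *)
Lemma weighted_sum1 {R : realType} {d n} {A : mdmatrix R d.+1 n}
    (hA : polystochastic A) (n_gt0 : (0 < n)%N) (i : 'I_n) (k : 'I_d)
    (h : 'I_d -> 'I_n -> R) :
    (forall q, q != k -> \sum_(x < n) h q x = 1) ->
  \sum_(j : mdindex d n)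
     A [tuple of i :: j] * \prod_(q | q != k) h q (tnth j q) = 1.
Proof.
move=> h_sum1; set S := LHS.
suff: S *+ n = 1 *+ n.
  rewrite -mulr_natr => /(canRL (mulfK _)) -> //; last by rewrite pnatr_eq0 -lt0n.
  by rewrite divff // pnatr_eq0 -lt0n.
rewrite -(sum_mdindex_set k).
transitivity (\sum_(j : mdindex d n) \prod_(q | q != k) h q (tnth j q)).
  apply: eq_bigr => j _; rewrite -[RHS]mul1r -(polystochastic_behead hA i k j).
  rewrite mulr_suml; apply: eq_bigr => x _; congr (_ * _).
  by apply: eq_bigr => q /negbTE qk; rewrite tnth_mdindex_set qk.
(* The coordinate k is given the weight 1, whose total is n. *)
under eq_bigr do rewrite big_mkcond /=.
rewrite (sum_mdindex_prod (fun q x => if q != k then h q x else 1)).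
rewrite (bigD1 k) //= eqxx sumr_const card_ord big1 ?mulr1 // => q qk.
by rewrite qk h_sum1.
Qed.

Theorem theorem6 (R : realType) (m p n : nat) (hn : (0 < n)%N)
    (A : mdmatrix R m.+1 n) (B : mdmatrix R p.+1 n)
    (hA : polystochastic A) (hB : polystochastic B) :
  polystochastic (circle_product A B).
Proof.
split=> [gamma|s gamma].
  rewrite ffunE; apply: sumr_ge0 => j _; apply: mulr_ge0; first exact: hA.1.
  by apply: prodr_ge0 => k _; apply: hB.1.
under eq_bigr do rewrite ffunE.
rewrite exchange_big.
case: (blockP s) => [|k l].
  transitivity (\sum_(j : mdindex m n)
                  \prod_k B [tuple of tnth j k :: block gamma k]).
    apply: eq_bigr => j _; rewrite -[RHS]mul1r.
    rewrite -(polystochastic_head hA hn j) mulr_suml.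
    apply: eq_bigr => x _; rewrite thead_mdindex_set0; congr (_ * _).
    by apply: eq_bigr => k _; rewrite block_mdindex_set0.
  rewrite (sum_mdindex_prod (fun k y => B [tuple of y :: block gamma k])).
  by apply: big1 => k _; apply: polystochastic_head hB hn _.
pose h q y := B [tuple of y :: block gamma q].
have h_sum1 q : q != k -> \sum_(y < n) h q y = 1.
  by move=> _; apply: polystochastic_head hB hn _.
rewrite -[RHS](weighted_sum1 hA hn (thead gamma) k h h_sum1).
apply: eq_bigr => j _.
rewrite -[RHS]mul1r -(polystochastic_behead hB (tnth j k) l (block gamma k)).
rewrite mulr_suml; apply: eq_bigr => x _.
rewrite thead_mdindex_set_block (bigD1 k) // block_mdindex_set_block eqxx.
rewrite mulrCA; congr (_ * (_ * _)).
by apply: eq_bigr => q /negbTE qk; rewrite block_mdindex_set_block qk.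
Qed.
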